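(* Let $G$ be a group, $A$ a set, and $\tau \in \mathrm{CA}(G;A)$. Suppose there exists $x \in A^{G}$ such that $x \in (A^{G})\tau$, but $x \neq (y)\tau$ for all $y\in A^G$ such that $G_x = G_y$. Then $\tau$ is not vN-regular.
   Context: Functions are applied on the right, and composition is read left to right: $\tau\sigma$ means first $\tau$, then $\sigma$. For a group $G$ and a set $A$, $A^G$ is the set of all functions $x: G\to A$; $G$ acts on $A^G$ by $(h)(x\cdot g) := (hg^{-1})x$ for $g,h\in G$, $x\in A^G$. A cellular automaton over $A^G$ is a map $\tau : A^G \to A^G$ for which there exist a finite subset $S \subseteq G$ (a memory set) and a function $\mu : A^S \to A$ (a local function) such that $(g)(x)\tau = ((x\cdot g^{-1})|_S)\mu$ for all $x\in A^G$, $g\in G$. $\mathrm{CA}(G;A)$ is the monoid of all cellular automata over $A^G$ under composition. $(A^G)\tau$ denotes the image of $\tau$. The stabiliser of $x \in A^G$ is $G_x := \{g\in G : x\cdot g = x\}$. An element $\tau\in \mathrm{CA}(G;A)$ is vN-regular (von Neumann regular) if there exists $\sigma\in \mathrm{CA}(G;A)$ with $\tau\sigma\tau=\tau$. *)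

(* Defs.v *)
From mathcomp Require Import all_boot.
From mathcomp Require Import boolp classical_sets functions cardinality.

Set Implicit Arguments.
Unset Strict Implicit.
Unset Printing Implicit Defensive.

Local Open Scope classical_set_scope.
Local Open Scope group_scope.

Section CellularAutomata.
Variables (G : groupType) (A : Type).
Implicit Types (x y : G -> A) (g h : G) (tau sigma : (G -> A) -> (G -> A)).

(* This is a right action: shift x (g * k) = shift (shift x g) k. *)
Definition shift x g : G -> A := fun h => x (h * g^-1).

Definition stabiliser x : set G := [set g | shift x g = x].

(* S is a memory set and mu a local function; sigL S restricts to S. *)
Definition CA : set ((G -> A) -> (G -> A)) :=
  [set tau | exists S : set G, finite_set S /\
     exists mu : (S -> A) -> A,
       forall x g, tau x g = mu (sigL S (shift x g^-1))].

(* f \; g is first f, then g. *)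
Definition vN_regular tau : Prop :=
  exists sigma, CA sigma /\ tau \; sigma \; tau = tau.

End CellularAutomata.

(* Main.v *)
(* If tau sigma tau = tau and x = tau z, then y = sigma x satisfies tau y = x.
   Cellular automata commute with the shift, hence can only enlarge stabilisers:
   G_x <= G_y <= G_{tau y} = G_x. *)
Require Import Defs.
From mathcomp Require Import all_boot.
From mathcomp Require Import boolp classical_sets functions cardinality.

(** A generalised inverse [sigma] sends each [x] in the image of [tau] to a preimage. Both maps are
    equivariant, so stabilisers can only grow along [x], [sigma x], [tau (sigma x) = x]; hence all
    are equal, against the choice of [x]. *)

Lemma shiftM (G : groupType) (A : Type) (x : G -> A) (g h : G) :
  shift x (g * h)%g = shift (shift x g) h.
Proof. by apply/funext => k; rewrite /shift invgM mulgA. Qed.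

(** At [h], both sides apply [mu] to the same pattern, since [(x·g)·h^-1 = x·(h g^-1)^-1]. *)
Lemma CA_shift (G : groupType) (A : Type) (tau : (G -> A) -> (G -> A)) :
  CA tau -> forall x g, tau (shift x g) = shift (tau x) g.
Proof.
move=> [S [_ [mu tauE]]] x g; apply/funext => h.
by rewrite {2}/shift !tauE -shiftM invgM invgK.
Qed.

Lemma CA_stabiliser (G : groupType) (A : Type) (tau : (G -> A) -> (G -> A))
    (x : G -> A) :
  CA tau -> (stabiliser x `<=` stabiliser (tau x))%classic.
Proof.
by move=> tauCA g; rewrite /stabiliser /= => xg; rewrite -CA_shift // xg.
Qed.

Theorem theorem1 (G : groupType) (A : Type) (tau : (G -> A) -> (G -> A))
  (tauCA : CA tau)
  (hx : exists x : G -> A,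
     range tau x /\
     forall y : G -> A, stabiliser x = stabiliser y -> x <> tau y) :
  ~ vN_regular tau.
Proof.
move=> [sigma [sigmaCA tauK]].
have [x [[z _ zx] xP]] := hx.
have tau_sigma : tau (sigma x) = x by rewrite -zx -[in RHS]tauK.
apply: (xP (sigma x)) => //; apply/seteqP; split; first exact: CA_stabiliser.
(* Reverse inclusion: [x] is read as [tau (sigma x)], so equivariance of [tau] applies at
   [sigma x]. *)
by rewrite -[X in (_ `<=` stabiliser X)%classic]tau_sigma; exact: CA_stabiliser.
Qed.
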